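(* In the setting described in the context, there exist a feature-difference distribution $P_{\tilde{\phi}}$ and a population distribution $\mathcal{H}$ such that, for some $\theta_{\mathrm{new}}\in\operatorname{supp}(\mathcal{H})$, $\lim_{N,M\to\infty} d_{\mathrm{TV}}(\hat P_{\mathrm{new}},P_{\mathrm{new}}\mid\tilde{\phi}^q)>0$ for all $\tilde{\phi}^q$, where $d_{\mathrm{TV}}(\hat P_{\mathrm{new}},P_{\mathrm{new}}\mid\tilde{\phi}^q)$ is the total variation distance between the predicted law $\mathbb{P}(\hat z^q_{\mathrm{new}}\mid\tilde{\phi}^q)$ and the true law $\mathbb{P}(z^q_{\mathrm{new}}\mid\tilde{\phi}^q)$ on $\{+1,-1\}$.
   Context: Setting. Each human type $i$ has a reward parameter $\theta_i^*\in\mathbb{R}^d$ drawn from a distribution $\mathcal{H}$. Feature differences $\tilde{\phi}\in\mathbb{R}^d$ are drawn i.i.d. from $P_{\tilde{\phi}}$, independently of the reward parameter. Given $\tilde{\phi}$, the binary label $z\in\{+1,-1\}$ of a human with parameter $\theta$ follows the Bradley–Terry model $\mathbb{P}(z=1\mid\tilde{\phi})=\sigma(\tilde{\phi}^\top\theta)$, $\sigma(t)=(1+e^{-t})^{-1}$. Training: for a type $i$ with $\theta_i^*\sim\mathcal{H}$ one has $N$ i.i.d. demonstrations $(\tilde{\phi}_i^l,z_i^l)$ and an independent query $(\tilde{\phi}_i^q,z_i^q)$; a linear-attention transformer with matrix $U\in\mathbb{R}^{d\times d}$ predicts $\mathbb{P}(\hat z_i^q=1)=\sigma(\frac1N\sum_{l=1}^N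 z_i^l(\tilde{\phi}_i^l)^\top U\tilde{\phi}_i^q)$, and $U_N^*$ is the minimizer of the expected cross-entropy $L_N(U)=-\frac12\mathbb{E}[(1+z_i^q)\log\mathbb{P}(\hat z_i^q=1)+(1-z_i^q)\log\mathbb{P}(\hat z_i^q=-1)]$ (expectation over $\theta_i^*\sim\mathcal{H}$, features and labels). Inference on a new human with parameter $\theta_{\mathrm{new}}$: given $M$ i.i.d. samples $(\tilde{\phi}^j,z^j_{\mathrm{new}})$ from this human and a query $\tilde{\phi}^q$, the predicted law is $\mathbb{P}(\hat z^q_{\mathrm{new}}=1\mid\tilde{\phi}^q)=\sigma(\frac1M\sum_{j=1}^M z^j_{\mathrm{new}}(\tilde{\phi}^j)^\top U_N^*\tilde{\phi}^q)$, while the true law is $\mathbb{P}(z^q_{\mathrm{new}}=1\mid\tilde{\phi}^q)=\sigma((\tilde{\phi}^q)^\top\theta_{\mathrm{new}})$. The limit $N,M\to\infty$ is taken for these (random) predicted probabilities. *)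

(* Defs.v *)
From HB Require Import structures.
From mathcomp Require Import all_boot all_order all_algebra.
From mathcomp Require Import all_classical all_reals all_analysis.
Set Implicit Arguments. Unset Strict Implicit. Unset Printing Implicit Defensive.
Import Order.TTheory GRing.Theory Num.Theory.
Local Open Scope ring_scope.

Section Defs.
Variable R : realType.

Definition sigmoid (t : R) : R := 1 / (1 + expR (- t)).

Record fdist (T : Type) := FDist {
  fsz : nat;
  fpt : 'I_fsz -> T;
  fw : 'I_fsz -> R;
  fw_ge0 : forall i, 0 <= fw i;
  fw_sum1 : \sum_(i < fsz) fw i = 1 }.
Arguments fsz {T} f.
Arguments fpt {T} f i.
Arguments fw {T} f i.

Definition in_supp T (D : fdist T) (x : T) : Prop :=
  exists i : 'I_(fsz D), 0 < fw D i /\ fpt D i = x.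

Variable d : nat.

Definition dotv (u v : 'rV[R]_d) : R := (u *m v^T) 0 0.
Definition bilin (u : 'rV[R]_d) (U : 'M[R]_d) (v : 'rV[R]_d) : R :=
  (u *m U *m v^T) 0 0.

(* labels z in {+1,-1} encoded by booleans *)
Definition lab (b : bool) : R := if b then 1 else -1.

Definition bt (theta phi : 'rV[R]_d) (b : bool) : R :=
  if b then sigmoid (dotv phi theta) else 1 - sigmoid (dotv phi theta).

Variables (P : fdist 'rV[R]_d) (H : fdist 'rV[R]_d).

(* a labelled sample: index of a feature difference in the support of P,
   together with the label *)
Notation sample := ('I_(fsz P) * bool)%type.

Definition sfeat (s : sample) : 'rV[R]_d := fpt P s.1.

Definition sweight (theta : 'rV[R]_d) (s : sample) : R :=
  fw P s.1 * bt theta (sfeat s) s.2.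

Definition icl_logit n (demo : {ffun 'I_n -> sample}) (U : 'M[R]_d)
  (phiq : 'rV[R]_d) : R :=
  (n%:R)^-1 * \sum_(l < n) lab (demo l).2 * bilin (sfeat (demo l)) U phiq.

Definition L_N (N : nat) (U : 'M[R]_d) : R :=
  \sum_(h < fsz H) \sum_(demo : {ffun 'I_N -> sample}) \sum_(q : sample)
    fw H h * (\prod_(l < N) sweight (fpt H h) (demo l)) * sweight (fpt H h) q *
    (- (1/2) * ((1 + lab q.2) * ln (sigmoid (icl_logit demo U (sfeat q)))
              + (1 - lab q.2) * ln (1 - sigmoid (icl_logit demo U (sfeat q))))).

Definition is_minimizer (N : nat) (U : 'M[R]_d) : Prop :=
  forall V : 'M[R]_d, L_N N U <= L_N N V.

(* total variation distance between two laws on {+1,-1} given by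
   their probabilities p, p' of the outcome +1 *)
Definition tv2 (p p' : R) : R := (1/2) * (`|p - p'| + `|(1 - p) - (1 - p')|).

Definition dtv_new (theta_new : 'rV[R]_d) (U : 'M[R]_d) (phiq : 'rV[R]_d)
  M (smp : {ffun 'I_M -> sample}) : R :=
  tv2 (sigmoid (icl_logit smp U phiq)) (sigmoid (dotv phiq theta_new)).

Definition prob_samples (theta : 'rV[R]_d) M
  (E : {ffun 'I_M -> sample} -> bool) : R :=
  \sum_(smp : {ffun 'I_M -> sample} | E smp) \prod_(j < M) sweight theta (smp j).

End Defs.

Arguments L_N {R d} P H N U.
Arguments is_minimizer {R d} P H N U.
Arguments icl_logit {R d P n} demo U phiq.
Arguments dtv_new {R d} P theta_new U phiq {M} smp.
Arguments prob_samples {R d} P theta M E.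

(* Main.v *)
Require Import Defs.
From HB Require Import structures.
From mathcomp Require Import all_boot all_order all_algebra.
From mathcomp Require Import all_classical all_reals all_analysis.
From mathcomp Require Import ring lra.
Import Order.TTheory GRing.Theory Num.Theory.
Import numFieldNormedType.Exports.

Set Implicit Arguments.
Unset Strict Implicit.
Unset Printing Implicit Defensive.
Local Open Scope ring_scope.

(* Take a single feature difference [phi] and two human types [theta = phi] and
   [theta = 3 phi].  On this data the transformer logit is [z * u], where [z] is
   the mean demonstration label and [u = U i0 i0], and the cross-entropy is a
   convex function of [u].  By the law of large numbers its derivative tends to
   a function that is negative below [3] and positive above [3] (the type
   weights are tuned for this), so the minimizers [U_N^*] satisfy [u -> 3].
   For the new human [theta = phi] the mean label tends to
   [m = 2 sigmoid 1 - 1], so the prediction tends to [sigmoid (3 m)] whereas the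
   truth is [sigmoid 1]; as [3 m > 1] these differ, and Chebyshev's inequality
   gives convergence in probability of [d_TV] to [|sigmoid (3 m) - sigmoid 1|]. *)

Lemma sumr_ge_term (R : numDomainType) (I : finType) (F : I -> R) i :
  (forall j, 0 <= F j) -> F i <= \sum_j F j.
Proof. by move=> F0; rewrite (bigD1 i) //= lerDl sumr_ge0. Qed.

Lemma eventually_natr_gt (R : archiRealFieldType) (x : R) :
  exists K : nat, forall N : nat, (K <= N)%N -> x < N%:R.
Proof.
by exists (Num.truncn x).+1 => N KN; apply: lt_le_trans (truncnS_gt x) _; rewrite ler_nat.
Qed.

Lemma sum_ord2 (V : nmodType) (F : 'I_2 -> V) : \sum_i F i = F ord0 + F ord_max.
Proof. by rewrite big_ord_recr big_ord1; congr (F _ + _); apply: val_inj. Qed.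

Lemma continuous_sumr (R : numFieldType) (I : finType) (F : I -> R -> R) :
  (forall i, continuous (F i)) -> continuous (fun u => \sum_i F i u).
Proof. by move=> FC; apply: continuous_big => //; exact: add_continuous. Qed.

Lemma expR1_gt2 (R : realType) : 2 < expR (1 : R).
Proof. by rewrite [2]/(1 + 1)%R expR_gt1Dx ?oner_neq0. Qed.

Lemma tangent_minimizer_between (R : realDomainType) (L D : R -> R) a b x :
  (forall u v, L u + (v - u) * D u <= L v) -> (forall v, L x <= L v) ->
  D a < 0 -> 0 < D b -> a <= x <= b.
Proof.
move=> tangent xmin Da Db.
have : (x - a) * D a <= 0 by have := tangent a x; have := xmin a; lra.
have : (x - b) * D b <= 0 by have := tangent b x; have := xmin b; lra.
rewrite (nmulr_lle0 _ Da) (pmulr_lle0 _ Db) subr_ge0 subr_le0 => xb ax.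
by rewrite ax.
Qed.

Lemma continuous_coercive_has_min (R : realType) (f : R -> R) (r : R) :
  0 <= r -> continuous f -> (forall t, r < `|t| -> f 0 <= f t) ->
  exists u, forall t, f u <= f t.
Proof.
move=> r0 fC coercive.
have Nrr : - r <= r by lra.
have [u _ umin] := EVT_min Nrr (continuous_subspaceT fC).
have r0_itv : (0 : R) \in `[- r, r] by rewrite in_itv /= oppr_le0 r0.
exists u => t; have [tr|tr] := leP `|t| r.
  by apply: umin; rewrite in_itv /= -ler_norml.
exact: le_trans (umin _ r0_itv) (coercive _ tr).
Qed.

Section Sigmoid.
Variable R : realType.
Implicit Types s t : R.

Lemma sigmoid_gt0 t : 0 < sigmoid t.
Proof. by rewrite /sigmoid div1r invr_gt0 addr_gt0 ?expR_gt0. Qed.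

Lemma sigmoid_lt1 t : sigmoid t < 1.
Proof. by rewrite /sigmoid div1r invf_lt1 ?addr_gt0 ?expR_gt0 // ltrDl expR_gt0. Qed.

Lemma sigmoidN t : sigmoid (- t) = 1 - sigmoid t.
Proof.
rewrite /sigmoid opprK expRN; have := expR_gt0 t => e0.
by field; rewrite !lt0r_neq0 // addr_gt0.
Qed.

Lemma sigmoid0 : sigmoid 0 = 1 / 2 :> R.
Proof. by rewrite /sigmoid oppr0 expR0. Qed.

Lemma sigmoid_lt s t : s < t -> sigmoid s < sigmoid t.
Proof.
move=> st; rewrite /sigmoid !div1r ltf_pV2 ?posrE ?addr_gt0 ?expR_gt0 //.
by rewrite ltrD2l ltr_expR ltrN2.
Qed.

Lemma sigmoid_le s t : s <= t -> sigmoid s <= sigmoid t.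
Proof. by rewrite le_eqVlt => /predU1P[->|/sigmoid_lt/ltW]. Qed.

Lemma sigmoidB_le s t : s <= t -> sigmoid t - sigmoid s <= t - s.
Proof.
move=> st; set a := expR (- s); set b := expR (- t).
have a0 : 0 < a by exact: expR_gt0.
have b0 : 0 < b by exact: expR_gt0.
have -> : sigmoid t - sigmoid s = (a - b) / ((1 + a) * (1 + b)).
  by rewrite /sigmoid -/a -/b; field; rewrite !lt0r_neq0 ?addr_gt0.
have ab : a - b <= a * (t - s).
  have -> : b = a * expR (s - t) by rewrite /a /b -expRD; congr expR; ring.
  have : a * (1 + (s - t)) <= a * expR (s - t) by rewrite ler_pM2l ?expR_ge1Dx.
  lra.
rewrite ler_pdivrMr ?mulr_gt0 ?addr_gt0 // mulrC; apply: (le_trans ab).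
by apply: ler_wpM2r; [rewrite subr_ge0 | nra].
Qed.

Lemma sigmoid_lipschitz s t : `|sigmoid s - sigmoid t| <= `|s - t|.
Proof.
wlog st : s t / s <= t.
  move=> W; have [/W//|/ltW ts] := leP s t.
  by rewrite distrC [`|s - t|]distrC; apply: W.
rewrite distrC [`|s - t|]distrC !ger0_norm ?subr_ge0 ?sigmoid_le //.
exact: sigmoidB_le.
Qed.

Definition logloss t : R := ln (1 + expR (- t)).

Lemma lnN_sigmoid t : - ln (sigmoid t) = logloss t.
Proof. by rewrite /sigmoid /logloss div1r lnV ?opprK // posrE addr_gt0 ?expR_gt0. Qed.

Lemma logloss_ge0 t : 0 <= logloss t.
Proof. by apply: ln_ge0; rewrite lerDl expR_ge0. Qed.

Lemma logloss_geN t : - t <= logloss t.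
Proof.
rewrite /logloss -{1}(expRK (- t)) ler_ln ?posrE ?addr_gt0 ?expR_gt0 //.
by rewrite lerDr.
Qed.

(* Convexity: with [q = 1 - sigmoid s], [1 + e^-t] factors as
   [(1 + e^-s) * (q e^(s-t) + 1 - q)], and [e^(q x) <= q e^x + 1 - q]. *)
Lemma logloss_tangent s t : logloss s + (t - s) * (sigmoid s - 1) <= logloss t.
Proof.
set A := 1 + expR (- s); have A0 : 0 < A by rewrite addr_gt0 ?expR_gt0.
set q := expR (- s) / A.
have q0 : 0 <= q by rewrite divr_ge0 ?expR_ge0 // ltW.
have q1 : q < 1 by rewrite ltr_pdivrMr // mul1r ltrDr ltr01.
have -> : sigmoid s - 1 = - q.
  by rewrite /sigmoid /q /A; field; rewrite lt0r_neq0 -/A.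
have factor : 1 + expR (- t) = A * (q * expR (s - t) + (1 - q)).
  rewrite /q /A expRD !expRN; have := expR_gt0 s => e0.
  by field; rewrite !lt0r_neq0 ?addr_gt0 ?expR_gt0.
have pos : 0 < q * expR (s - t) + (1 - q).
  have : 0 <= q * expR (s - t) by rewrite mulr_ge0 ?expR_ge0.
  lra.
rewrite /logloss factor lnM ?posrE // lerD2l.
have -> : (t - s) * - q = q * (s - t) by ring.
rewrite -[X in X <= _]expRK ler_ln ?posrE ?expR_gt0 //.
have := @convex_expR R (Itv01 q0 (ltW q1)) (s - t) 0.
by rewrite !convRE /= mulr0 addr0 expR0 mulr1.
Qed.

Lemma continuous_logloss : continuous (fun t : R => logloss t).
Proof.
move=> x; change {for x, continuous (@ln R \o (fun t => 1 + expR (- t)))}.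
apply: continuous_comp.
  apply: continuousD; first exact: cst_continuous.
  apply: (@continuous_comp R R R -%R expR); first exact: opp_continuous.
  exact: continuous_expR.
by apply: continuous_ln; rewrite addr_gt0 ?expR_gt0.
Qed.

Lemma logloss_mix_ge (p t : R) : 0 < p < 1 ->
  p * (1 - p) * `|t| <= p * logloss t + (1 - p) * logloss (- t).
Proof.
case/andP=> p0 p1; have q0 : 0 < 1 - p by rewrite subr_gt0.
have := mulr_ge0 (ltW p0) (logloss_ge0 t).
have := mulr_ge0 (ltW q0) (logloss_ge0 (- t)).
have ltN := logloss_geN (- t); rewrite opprK in ltN.
have [t0|t0] := leP 0 t; [rewrite ger0_norm // | rewrite ltr0_norm //].
- have := ler_wpM2l (ltW q0) ltN.
  have := ler_piMl (mulr_ge0 (ltW q0) t0) (ltW p1).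
  lra.
- have := ler_wpM2l (ltW p0) (logloss_geN t).
  have : 1 - p <= 1 by rewrite lerBlDr lerDl ltW.
  have tN : 0 <= - t by rewrite oppr_ge0 ltW.
  move/(ler_piMl (mulr_ge0 (ltW p0) tN)).
  lra.
Qed.

Definition xent (b : bool) t : R :=
  - (1/2) * ((1 + lab R b) * ln (sigmoid t) + (1 - lab R b) * ln (1 - sigmoid t)).

Lemma xentE b t : xent b t = logloss (if b then t else - t).
Proof. by case: b; rewrite /xent /lab -lnN_sigmoid ?sigmoidN; field. Qed.

Lemma xent_tangent b s t : xent b s + (t - s) * (sigmoid s - b%:R) <= xent b t.
Proof.
rewrite !xentE; case: b; first exact: logloss_tangent.
have := logloss_tangent (- s) (- t); rewrite sigmoidN.
by have -> : (- t - - s) * (1 - sigmoid s - 1) = (t - s) * (sigmoid s - 0) by ring.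
Qed.

Lemma xent_ge0 b t : 0 <= xent b t.
Proof. by rewrite xentE logloss_ge0. Qed.

Lemma xent0 b : xent b 0 = ln 2.
Proof. by rewrite xentE oppr0 if_same /logloss oppr0 expR0. Qed.

Lemma continuous_xent b : continuous (fun t : R => xent b t).
Proof.
have -> : xent b = logloss \o (fun t => if b then t else - t).
  by apply/funext => t; rewrite xentE.
move=> x; apply: continuous_comp; last exact: continuous_logloss.
by case: b; [exact: cvg_id | exact: opp_continuous].
Qed.

End Sigmoid.

Lemma normr_le_add_sqr_div (R : realFieldType) (z eta : R) :
  0 < eta -> `|z| <= eta + z ^+ 2 / eta.
Proof.
move=> eta0; rewrite -real_normK ?num_real //; have := normr_ge0 z.
set a := `|z| => a0; rewrite -(@ler_pM2r _ eta) // mulrDl mulfVK ?gt_eqF //.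
nra.
Qed.

Section IidSamples.
Variables (R : realFieldType) (S : finType) (pi : S -> R).
Implicit Types (N : nat) (x y : S -> R) (m v : R).

Definition emp_mean {N} x (f : {ffun 'I_N -> S}) : R := (N%:R)^-1 * \sum_l x (f l).

Lemma sum_iid_prod N (h : 'I_N -> S -> R) :
  \sum_(f : {ffun 'I_N -> S}) (\prod_l pi (f l)) * \prod_l h l (f l) =
  \prod_l \sum_s pi s * h l s.
Proof. by rewrite bigA_distr_bigA; apply: eq_bigr => f _; rewrite -big_split. Qed.

Hypothesis pi_sum1 : \sum_s pi s = 1.

Lemma sum_iid1 N : \sum_(f : {ffun 'I_N -> S}) \prod_l pi (f l) = 1.
Proof.
have /= := @sum_iid_prod N (fun _ _ => 1); under eq_bigr do rewrite big1_eq mulr1.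
by move=> ->; apply: big1 => l _; under eq_bigr do rewrite mulr1.
Qed.

Lemma expect_coord N (i : 'I_N) x :
  \sum_(f : {ffun 'I_N -> S}) (\prod_l pi (f l)) * x (f i) = \sum_s pi s * x s.
Proof.
have /= := @sum_iid_prod N (fun l s => if l == i then x s else 1).
under eq_bigr do rewrite -big_mkcond big_pred1_eq.
move=> ->; rewrite (bigD1 i) //= [X in _ * X]big1 ?mulr1 => [|l /negbTE ->].
  by under eq_bigr do rewrite eqxx.
by under eq_bigr do rewrite mulr1.
Qed.

Lemma expect_coord_pair N (i j : 'I_N) y : i != j ->
  \sum_(f : {ffun 'I_N -> S}) (\prod_l pi (f l)) * (y (f i) * y (f j)) =
  (\sum_s pi s * y s) * (\sum_s pi s * y s).
Proof.
move=> ij.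
have /= := @sum_iid_prod N
  (fun l s => (if l == i then y s else 1) * (if l == j then y s else 1)).
under eq_bigr do rewrite big_split /= -!big_mkcond !big_pred1_eq.
move=> ->; rewrite (bigD1 i) //= (bigD1 j) /=; last by rewrite eq_sym.
rewrite [X in _ * (_ * X)]big1 ?mulr1; last first.
  move=> l /andP[/negbTE lj /negbTE li]; rewrite li lj.
  by under eq_bigr do rewrite !mulr1.
rewrite eqxx (negbTE ij) eq_sym (negbTE ij) eqxx.
by congr (_ * _); apply: eq_bigr => s _; rewrite ?mulr1 ?mul1r.
Qed.

(* For centered [y] the cross terms [E y_i y_j], [i != j], vanish. *)
Lemma expect_sum_sqr N y : \sum_s pi s * y s = 0 ->
  \sum_(f : {ffun 'I_N -> S}) (\prod_l pi (f l)) * (\sum_l y (f l)) ^+ 2 =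
  N%:R * \sum_s pi s * y s ^+ 2.
Proof.
move=> y0.
transitivity (\sum_i \sum_j \sum_(f : {ffun 'I_N -> S})
                (\prod_l pi (f l)) * (y (f i) * y (f j))).
  have expand (f : {ffun 'I_N -> S}) :
      (\prod_l pi (f l)) * (\sum_l y (f l)) ^+ 2 =
      \sum_i \sum_j (\prod_l pi (f l)) * (y (f i) * y (f j)).
    rewrite expr2 mulr_suml mulr_sumr; apply: eq_bigr => i _.
    by rewrite !mulr_sumr.
  under eq_bigr do rewrite expand.
  by rewrite exchange_big; apply: eq_bigr => i _; rewrite exchange_big.
set V := \sum_s pi s * y s ^+ 2.
rewrite (eq_bigr (fun=> V)) => [|i _]; first by rewrite sumr_const card_ord mulr_natl.
rewrite (bigD1 i) //= [X in _ + X]big1 ?addr0 => [|j ji]; last first.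
  by rewrite expect_coord_pair 1?eq_sym // y0 mul0r.
by rewrite (expect_coord i (fun s => y s * y s)); under eq_bigr do rewrite -expr2.
Qed.

Lemma var_emp_mean N x m : (0 < N)%N -> \sum_s pi s * x s = m ->
  \sum_(f : {ffun 'I_N -> S}) (\prod_l pi (f l)) * (emp_mean x f - m) ^+ 2 =
  (N%:R)^-1 * \sum_s pi s * (x s - m) ^+ 2.
Proof.
move=> N0 xm; have N0' : N%:R != 0 :> R by rewrite pnatr_eq0 -lt0n.
have centered (f : {ffun 'I_N -> S}) :
    emp_mean x f - m = (N%:R)^-1 * \sum_l (x (f l) - m).
  rewrite /emp_mean sumrB mulrBr; congr (_ - _).
  by rewrite sumr_const card_ord -[m *+ N]mulr_natl mulrA mulVf ?mul1r.
under eq_bigr do rewrite centered exprMn mulrCA.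
rewrite -mulr_sumr (@expect_sum_sqr N (fun s => x s - m)); first by field.
by under eq_bigr do rewrite mulrBr; rewrite sumrB xm -mulr_suml pi_sum1 mul1r subrr.
Qed.

Hypothesis pi_ge0 : forall s, 0 <= pi s.

Lemma prod_pi_ge0 N (f : {ffun 'I_N -> S}) : 0 <= \prod_l pi (f l).
Proof. exact: prodr_ge0. Qed.

Lemma markov_iid N (E : pred {ffun 'I_N -> S}) (Q : {ffun 'I_N -> S} -> R) eta :
  0 < eta -> (forall f, 0 <= Q f) -> (forall f, E f -> eta <= Q f) ->
  \sum_(f | E f) \prod_l pi (f l) <=
  eta^-1 * \sum_(f : {ffun 'I_N -> S}) (\prod_l pi (f l)) * Q f.
Proof.
move=> eta0 Q0 EQ; rewrite mulr_sumr big_mkcond /=; apply: ler_sum => f _.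
case: ifP => Ef; last by rewrite !mulr_ge0 ?invr_ge0 ?prod_pi_ge0 ?Q0 ?ltW.
rewrite mulrCA -[X in X <= _]mulr1 ler_wpM2l ?prod_pi_ge0 //.
by rewrite ler_pdivlMl // mulr1 EQ.
Qed.

Lemma chebyshev_emp_mean N x m v r (E : pred {ffun 'I_N -> S}) :
  (0 < N)%N -> \sum_s pi s * x s = m -> \sum_s pi s * (x s - m) ^+ 2 <= v ->
  0 < r -> (forall f, E f -> r <= `|emp_mean x f - m|) ->
  \sum_(f | E f) \prod_l pi (f l) <= v / (N%:R * r ^+ 2).
Proof.
move=> N0 xm xv r0 Er.
have r20 : 0 < r ^+ 2 by rewrite exprn_gt0.
apply: le_trans (@markov_iid N E (fun f => (emp_mean x f - m) ^+ 2) _ r20 _ _) _.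
- by move=> f; rewrite sqr_ge0.
- move=> f /Er rf; rewrite -[(_ - m) ^+ 2]real_normK ?num_real //.
  by rewrite lerXn2r ?nnegrE ?normr_ge0 ?(ltW r0).
rewrite /= var_emp_mean // mulrA -invfM mulrC [r ^+ 2 * _]mulrC.
by apply: ler_wpM2r; rewrite // invr_ge0 mulr_ge0 ?ler0n ?ltW.
Qed.

(* The free parameter [eta] comes from [|z| <= eta + z^2 / eta], which turns
   the variance of the empirical mean into a bound on its mean deviation. *)
Lemma expect_lipschitz_emp_mean N x m v (g : R -> R) L eta :
  (0 < N)%N -> \sum_s pi s * x s = m -> \sum_s pi s * (x s - m) ^+ 2 <= v ->
  0 <= L -> 0 < eta -> (forall z, `|g z - g m| <= L * `|z - m|) ->
  `|\sum_(f : {ffun 'I_N -> S}) (\prod_l pi (f l)) * g (emp_mean x f) - g m|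
    <= L * (eta + v / (N%:R * eta)).
Proof.
move=> N0 xm xv L0 eta0 gL.
rewrite -[g m]mul1r -[X in X * g m](sum_iid1 N) mulr_suml -sumrB.
apply: le_trans (ler_norm_sum _ _ _) _.
apply: (@le_trans _ _ (\sum_(f : {ffun 'I_N -> S}) (\prod_l pi (f l)) *
   (L * (eta + (emp_mean x f - m) ^+ 2 / eta)))).
  apply: ler_sum => f _; rewrite -mulrBr normrM ger0_norm ?prod_pi_ge0 //.
  apply: ler_wpM2l; first exact: prod_pi_ge0.
  by apply: le_trans (gL _) _; rewrite ler_wpM2l ?normr_le_add_sqr_div.
under eq_bigr do rewrite mulrCA mulrDr.
rewrite -mulr_sumr ler_wpM2l // big_split /= -mulr_suml sum_iid1 mul1r lerD2l.
under eq_bigr do rewrite mulrA.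
rewrite -mulr_suml var_emp_mean // invfM mulrA ler_pM2r ?invr_gt0 //.
by rewrite mulrC ler_pM2r ?invr_gt0 ?ltr0n.
Qed.

End IidSamples.

Section Model.
Variables (R : realType) (d : nat).
Hypothesis d_gt0 : (0 < d)%N.

Definition i0 : 'I_d := Ordinal d_gt0.
Definition phi : 'rV[R]_d := delta_mx 0 i0.
Definition theta (t : R) : 'rV[R]_d := t *: phi.

Lemma bilin_phi U : bilin phi U phi = U i0 i0.
Proof. by rewrite /bilin /phi -rowE trmx_delta -colE !mxE. Qed.

Lemma dotv_theta t : dotv phi (theta t) = t.
Proof. by rewrite /dotv /phi -rowE !mxE eqxx mulr1. Qed.

Lemma phi_law_sum1 : \sum_(i < 1) 1 = 1 :> R.
Proof. by rewrite big_ord1. Qed.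

Definition phi_law : fdist R 'rV[R]_d := FDist (fun=> phi) (fun=> ler01) phi_law_sum1.

Local Notation sample := ('I_1 * bool)%type.

Lemma sum_sample (F : sample -> R) : \sum_s F s = F (ord0, true) + F (ord0, false).
Proof.
rewrite (eq_bigr (fun s => F (s.1, s.2))) => [|[]//].
by rewrite -(pair_bigA _ (fun i b => F (i, b))) /= big_ord1 big_bool.
Qed.

Definition sample_label (s : sample) : R := lab R s.2.

Definition label_law (t : R) (s : sample) : R := @sweight R d phi_law (theta t) s.

Lemma label_lawE t s : label_law t s = if s.2 then sigmoid t else 1 - sigmoid t.
Proof. by rewrite /label_law /sweight /= mul1r /bt /sfeat /= dotv_theta. Qed.

Lemma label_law_ge0 t s : 0 <= label_law t s.
Proof.
by rewrite label_lawE; case: s.2; rewrite ?subr_ge0 ltW ?sigmoid_gt0 ?sigmoid_lt1.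
Qed.

Lemma label_law_sum1 t : \sum_s label_law t s = 1.
Proof. by rewrite sum_sample !label_lawE /=; ring. Qed.

Definition mean_label (t : R) : R := 2 * sigmoid t - 1.

Lemma label_law_mean t : \sum_s label_law t s * sample_label s = mean_label t.
Proof. by rewrite sum_sample !label_lawE /sample_label /lab /= /mean_label; ring. Qed.

Lemma label_law_var t : \sum_s label_law t s * (sample_label s - mean_label t) ^+ 2 <= 1.
Proof.
rewrite sum_sample !label_lawE /sample_label /lab /= /mean_label; set p := sigmoid t.
have -> : p * (1 - (2 * p - 1)) ^+ 2 + (1 - p) * (-1 - (2 * p - 1)) ^+ 2 =
  1 - (2 * p - 1) ^+ 2 by ring.
by rewrite lerBlDr lerDl sqr_ge0.
Qed.

Lemma mean_label_gt0 t : 0 < t -> 0 < mean_label t.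
Proof. by move/sigmoid_lt; rewrite sigmoid0 /mean_label; lra. Qed.

Lemma mean_label_lt1 t : mean_label t < 1.
Proof. by have := sigmoid_lt1 t; rewrite /mean_label; lra. Qed.

Lemma norm_mean_label_le1 t : `|mean_label t| <= 1.
Proof.
have := sigmoid_gt0 t; have := sigmoid_lt1 t; rewrite /mean_label => t1 t0.
by rewrite ler_norml; apply/andP; split; lra.
Qed.

Lemma mean_label1_gt : 1 < mean_label 1 * 3.
Proof.
have e2 := @expR1_gt2 R.
rewrite /mean_label /sigmoid expRN; set e := expR 1 in e2 *.
rewrite -subr_gt0 (_ : _ - 1 = (2 * e - 4) / (e + 1)).
  by apply: divr_gt0; lra.
by field; rewrite lt0r_neq0 //; lra.
Qed.

Lemma norm_emp_mean_label_le1 N (smp : {ffun 'I_N -> sample}) :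
  (0 < N)%N -> `|emp_mean sample_label smp| <= 1.
Proof.
move=> N0; rewrite /emp_mean normrM ger0_norm ?invr_ge0 ?ler0n //.
rewrite ler_pdivrMl ?ltr0n // mulr1; apply: le_trans (ler_norm_sum _ _ _) _.
rewrite (eq_bigr (fun=> 1)) => [|l _]; first by rewrite sumr_const card_ord.
by rewrite /sample_label /lab; case: (smp l).2; rewrite ?normrN normr1.
Qed.

Lemma icl_logit_phi N (demo : {ffun 'I_N -> sample}) U :
  icl_logit (P := phi_law) demo U phi = emp_mean sample_label demo * U i0 i0.
Proof.
rewrite /icl_logit /emp_mean -mulrA mulr_suml; congr (_ * _).
by apply: eq_bigr => l _; rewrite /sfeat /= bilin_phi.
Qed.


Definition grad_term (t u z : R) : R := z * (sigmoid (z * u) - sigmoid t).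

Lemma grad_term_lipschitz t u z m : `|m| <= 1 ->
  `|grad_term t u z - grad_term t u m| <= (1 + `|u|) * `|z - m|.
Proof.
move=> m1.
have -> : grad_term t u z - grad_term t u m =
  (z - m) * (sigmoid (z * u) - sigmoid t) + m * (sigmoid (z * u) - sigmoid (m * u)).
  by rewrite /grad_term; ring.
apply: le_trans (ler_normD _ _) _; rewrite !normrM mulrDl mul1r lerD //.
  rewrite -[X in _ <= X]mulr1 ler_wpM2l // ler_norml.
  have := sigmoid_gt0 (z * u); have := sigmoid_lt1 (z * u).
  by have := sigmoid_gt0 t; have := sigmoid_lt1 t; move=> *; apply/andP; split; lra.
apply: le_trans (ler_wpM2r (normr_ge0 _) m1) _; rewrite mul1r.
by apply: le_trans (sigmoid_lipschitz _ _) _; rewrite -mulrBl normrM mulrC.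
Qed.

Definition tparam (h : 'I_2) : R := if h == ord0 then 1 else 3.

Definition grad_low : R := grad_term 1 3 (mean_label 1).
Definition grad_high : R := grad_term 3 3 (mean_label 3).

Lemma grad_low_gt0 : 0 < grad_low.
Proof.
rewrite /grad_low /grad_term mulr_gt0 ?mean_label_gt0 // subr_gt0.
exact/sigmoid_lt/mean_label1_gt.
Qed.

Lemma grad_high_lt0 : grad_high < 0.
Proof.
rewrite /grad_high /grad_term pmulr_rlt0 ?mean_label_gt0 // subr_lt0.
by apply: sigmoid_lt; rewrite gtr_pMl ?mean_label_lt1.
Qed.

(* Chosen so that [tweight ord0 * grad_low + tweight ord_max * grad_high = 0],
   i.e. [u = 3] solves the population-level stationarity equation. *)
Definition tweight (h : 'I_2) : R :=
  if h == ord0 then - grad_high / (grad_low - grad_high)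
  else grad_low / (grad_low - grad_high).

Lemma tweight_gt0 h : 0 < tweight h.
Proof.
have := grad_low_gt0; have := grad_high_lt0 => gh gl.
by rewrite /tweight; case: (h == ord0); apply: divr_gt0; lra.
Qed.

Lemma tweight_sum1 : \sum_h tweight h = 1.
Proof.
have := grad_low_gt0; have := grad_high_lt0 => gh gl.
by rewrite sum_ord2 /tweight /=; field; apply/eqP; lra.
Qed.

Lemma tweight_ge0 h : 0 <= tweight h.
Proof. exact/ltW/tweight_gt0. Qed.

Definition population : fdist R 'rV[R]_d :=
  FDist (fun h => theta (tparam h)) tweight_ge0 tweight_sum1.

Lemma theta1_in_supp : in_supp population (theta 1).
Proof. by exists ord0; split; first exact: tweight_gt0. Qed.

Definition joint_weight N h (demo : {ffun 'I_N -> sample}) (q : sample) : R :=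
  tweight h * (\prod_l label_law (tparam h) (demo l)) * label_law (tparam h) q.

Lemma joint_weight_ge0 N h (demo : {ffun 'I_N -> sample}) q :
  0 <= joint_weight h demo q.
Proof.
apply: mulr_ge0; last exact: label_law_ge0.
by rewrite mulr_ge0 ?tweight_ge0 // prodr_ge0 // => l _; exact: label_law_ge0.
Qed.

Definition loss N (u : R) : R :=
  \sum_h \sum_(demo : {ffun 'I_N -> sample}) \sum_q
    joint_weight h demo q * xent q.2 (emp_mean sample_label demo * u).

Lemma L_N_phi N U : L_N phi_law population N U = loss N (U i0 i0).
Proof.
apply: eq_bigr => h _; apply: eq_bigr => demo _; apply: eq_bigr => q _.
by rewrite /xent -icl_logit_phi.
Qed.

Definition grad N (u : R) : R :=
  \sum_h \sum_(demo : {ffun 'I_N -> sample}) \sum_q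
    let z := emp_mean sample_label demo in
    joint_weight h demo q * (z * (sigmoid (z * u) - q.2%:R)).

Lemma loss_tangent N u v : loss N u + (v - u) * grad N u <= loss N v.
Proof.
rewrite /loss /grad mulr_sumr -big_split /=; apply: ler_sum => h _.
rewrite mulr_sumr -big_split /=; apply: ler_sum => demo _.
rewrite mulr_sumr -big_split /=; apply: ler_sum => q _.
rewrite [(v - u) * _]mulrCA -mulrDr ler_wpM2l ?joint_weight_ge0 //.
set z := emp_mean sample_label demo.
have -> : (v - u) * (z * (sigmoid (z * u) - q.2%:R)) =
  (z * v - z * u) * (sigmoid (z * u) - q.2%:R) by ring.
exact: xent_tangent.
Qed.

Lemma gradE N u : grad N u = \sum_h tweight h *
  \sum_(demo : {ffun 'I_N -> sample})
    (\prod_l label_law (tparam h) (demo l)) *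
    grad_term (tparam h) u (emp_mean sample_label demo).
Proof.
apply: eq_bigr => h _; rewrite mulr_sumr; apply: eq_bigr => demo _.
by rewrite sum_sample /joint_weight !label_lawE /= /grad_term; ring.
Qed.

Definition grad_lim (u : R) : R :=
  \sum_h tweight h * grad_term (tparam h) u (mean_label (tparam h)).

Lemma grad_cvg u e : 0 < e -> exists K, forall N, (K <= N)%N ->
  `|grad N u - grad_lim u| <= e.
Proof.
move=> e0; set L := 1 + `|u|; have L0 : 0 < L by rewrite ltr_pwDl.
set eta := e / (2 * L); have eta0 : 0 < eta by rewrite divr_gt0 ?mulr_gt0.
have [K HK] := eventually_natr_gt (4 * L ^+ 2 / e ^+ 2).
have Kpos : (0 < K.+1)%N by [].
exists K.+1 => N KN; have N0 : (0 < N)%N := leq_trans Kpos KN.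
have bound : L * (eta + 1 / (N%:R * eta)) <= e.
  have NK := HK N (ltnW KN); have N0' : (0 : R) < N%:R by rewrite ltr0n.
  rewrite /eta (_ : L * _ = e / 2 + 2 * L ^+ 2 / (N%:R * e)); last first.
    by field; rewrite !gt_eqF.
  suff : 2 * L ^+ 2 / (N%:R * e) <= e / 2 by lra.
  rewrite ler_pdivrMr ?mulr_gt0 // (_ : e / 2 * (N%:R * e) = N%:R * e ^+ 2 / 2); last first.
    by rewrite expr2; field.
  by move: NK; rewrite ltr_pdivrMr ?exprn_gt0 //; lra.
rewrite gradE /grad_lim -sumrB; apply: le_trans (ler_norm_sum _ _ _) _.
rewrite -[e]mul1r -[X in X * e]tweight_sum1 mulr_suml; apply: ler_sum => h _.
rewrite -mulrBr normrM ger0_norm ?tweight_ge0 // ler_wpM2l ?tweight_ge0 //.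
apply: le_trans _ bound.
apply: (expect_lipschitz_emp_mean (label_law_sum1 _) (label_law_ge0 _) N0
  (label_law_mean _) (label_law_var _) (ltW L0) eta0).
by move=> z; apply: grad_term_lipschitz; exact: norm_mean_label_le1.
Qed.

Lemma grad_limE v : grad_lim v = \sum_h tweight h *
  (mean_label (tparam h) * (sigmoid (mean_label (tparam h) * v)
                            - sigmoid (mean_label (tparam h) * 3))).
Proof.
have grad_lim3 : grad_lim 3 = 0.
  rewrite /grad_lim sum_ord2 -/grad_low -/grad_high /tweight /=.
  have := grad_low_gt0; have := grad_high_lt0 => gh gl.
  by field; apply/eqP; lra.
by rewrite -[LHS]subr0 -[X in _ - X]grad_lim3 /grad_lim !sum_ord2 /grad_term /=; ring.
Qed.

Lemma mean_tparam_gt0 h : 0 < mean_label (tparam h).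
Proof. by rewrite mean_label_gt0 // /tparam; case: (h == ord0). Qed.

Lemma grad_lim_gt0 v : 3 < v -> 0 < grad_lim v.
Proof.
move=> v3; rewrite grad_limE sum_ord2.
have pos h : 0 < tweight h * (mean_label (tparam h) *
    (sigmoid (mean_label (tparam h) * v) - sigmoid (mean_label (tparam h) * 3))).
  rewrite !pmulr_rgt0 ?tweight_gt0 ?mean_tparam_gt0 //.
  by rewrite subr_gt0 sigmoid_lt // ltr_pM2l ?mean_tparam_gt0.
by have := pos ord0; have := pos ord_max; lra.
Qed.

Lemma grad_lim_lt0 v : v < 3 -> grad_lim v < 0.
Proof.
move=> v3; rewrite grad_limE sum_ord2.
have neg h : tweight h * (mean_label (tparam h) *
    (sigmoid (mean_label (tparam h) * v) - sigmoid (mean_label (tparam h) * 3))) < 0.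
  rewrite !pmulr_rlt0 ?tweight_gt0 ?mean_tparam_gt0 //.
  by rewrite subr_lt0 sigmoid_lt // ltr_pM2l ?mean_tparam_gt0.
by have := neg ord0; have := neg ord_max; lra.
Qed.

Lemma continuous_loss N : continuous (loss N).
Proof.
apply: continuous_sumr => h; apply: continuous_sumr => demo.
apply: continuous_sumr => q x.
set z := emp_mean sample_label demo.
apply: (@continuous_comp _ _ _ (fun u => xent q.2 (z * u)) ( *%R (joint_weight h demo q))).
  apply: (@continuous_comp _ _ _ ( *%R z) (xent q.2)); first exact: mulrl_continuous.
  exact: continuous_xent.
exact: mulrl_continuous.
Qed.

Lemma joint_weight_sum1 N :
  \sum_h \sum_(demo : {ffun 'I_N -> sample}) \sum_q joint_weight h demo q = 1.
Proof.
rewrite -[RHS]tweight_sum1; apply: eq_bigr => h _.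
under eq_bigr do rewrite /joint_weight -mulr_sumr label_law_sum1 mulr1.
by rewrite -mulr_sumr sum_iid1 ?mulr1 //; exact: label_law_sum1.
Qed.

Lemma loss0 N : loss N 0 = ln 2.
Proof.
rewrite -[RHS]mul1r -[X in X * _](joint_weight_sum1 N) mulr_suml.
apply: eq_bigr => h _.
rewrite mulr_suml; apply: eq_bigr => demo _; rewrite mulr_suml.
by apply: eq_bigr => q _; rewrite mulr0 xent0.
Qed.

Lemma loss_no_demo u : loss 0 u = loss 0 0.
Proof.
apply: eq_bigr => h _; apply: eq_bigr => demo _; apply: eq_bigr => q _.
by rewrite /emp_mean !big_ord0 !mulr0 mul0r.
Qed.

Definition all_true N : {ffun 'I_N -> sample} := [ffun=> (ord0, true)].

Lemma emp_mean_all_true N : (0 < N)%N -> emp_mean sample_label (all_true N) = 1.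
Proof.
move=> N0; rewrite /emp_mean (eq_bigr (fun=> 1)) => [|l _]; last by rewrite ffunE.
by rewrite sumr_const card_ord -[1 *+ N]mulr_natl mulr1 mulVf // pnatr_eq0 -lt0n.
Qed.

Definition coercivity N : R :=
  tweight ord0 * sigmoid 1 ^+ N * (sigmoid 1 * (1 - sigmoid 1)).

Lemma coercivity_gt0 N : 0 < coercivity N.
Proof.
apply: mulr_gt0; first by rewrite mulr_gt0 ?tweight_gt0 ?exprn_gt0 ?sigmoid_gt0.
by rewrite mulr_gt0 ?sigmoid_gt0 // subr_gt0 sigmoid_lt1.
Qed.

(* Keep only the demonstration sequence with all labels [+1] of the type
   [theta = 1 * phi]: its logit is [u] itself. *)
Lemma loss_ge_norm N u : (0 < N)%N -> coercivity N * `|u| <= loss N u.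
Proof.
move=> N0.
have term_ge0 h demo q :
    0 <= joint_weight h demo q * xent q.2 (emp_mean sample_label demo * u).
  by rewrite mulr_ge0 ?joint_weight_ge0 ?xent_ge0.
apply: le_trans (sumr_ge_term ord0 _) => [|h]; last first.
  by apply: sumr_ge0 => demo _; apply: sumr_ge0 => q _; exact: term_ge0.
apply: le_trans (sumr_ge_term (all_true N) _) => [|demo]; last first.
  by apply: sumr_ge0 => q _; exact: term_ge0.
have weight_all_true : \prod_l label_law 1 (all_true N l) = sigmoid 1 ^+ N.
  rewrite (eq_bigr (fun=> sigmoid 1)) ?prodr_const ?card_ord // => l _.
  by rewrite ffunE label_lawE.
rewrite sum_sample /joint_weight /= emp_mean_all_true // mul1r !xentE !label_lawE /=.
rewrite weight_all_true /coercivity; set a := _ * _ ^+ N; set p := sigmoid 1.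
have a0 : 0 <= a by rewrite mulr_ge0 ?exprn_ge0 ?ltW ?tweight_gt0 ?sigmoid_gt0.
have p01 : 0 < p < 1 by rewrite sigmoid_gt0 sigmoid_lt1.
rewrite -mulrA; apply: le_trans (ler_wpM2l a0 (logloss_mix_ge u p01)) _.
by rewrite mulrDr !mulrA.
Qed.

Lemma exists_minimizer N : exists U : 'M[R]_d, is_minimizer phi_law population N U.
Proof.
suff [u umin] : exists u, forall t, loss N u <= loss N t.
  by exists u%:M => V; rewrite !L_N_phi mxE eqxx mulr1n.
case: N => [|N]; first by exists 0 => t; rewrite loss_no_demo.
have c0 := coercivity_gt0 N.+1.
apply: (@continuous_coercive_has_min _ _ (coercivity N.+1)^-1).
- by rewrite invr_ge0 ltW.
- exact: continuous_loss.
move=> t tbig; rewrite loss0.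
have ln2_le1 : ln 2 <= 1 :> R by rewrite -ler_expR lnK ?posrE // ltW ?expR1_gt2.
apply: le_trans ln2_le1 (le_trans _ (loss_ge_norm t (ltn0Sn N))).
by rewrite -(mulfV (lt0r_neq0 c0)) ler_wpM2l ?ltW.
Qed.

Lemma minimizer_cvg (Ustar : nat -> 'M[R]_d) :
  (forall N, is_minimizer phi_law population N (Ustar N)) ->
  forall eps, 0 < eps -> exists K, forall N, (K <= N)%N -> `|Ustar N i0 i0 - 3| <= eps.
Proof.
move=> Umin eps eps0.
have gpos : 0 < grad_lim (3 + eps) by apply: grad_lim_gt0; lra.
have gneg : grad_lim (3 - eps) < 0 by apply: grad_lim_lt0; lra.
have [K1 HK1] : exists K, forall N, (K <= N)%N ->
    `|grad N (3 + eps) - grad_lim (3 + eps)| <= grad_lim (3 + eps) / 2.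
  by apply: grad_cvg; lra.
have [K2 HK2] : exists K, forall N, (K <= N)%N ->
    `|grad N (3 - eps) - grad_lim (3 - eps)| <= - grad_lim (3 - eps) / 2.
  by apply: grad_cvg; lra.
exists (maxn K1 K2) => N; rewrite geq_max => /andP[/HK1 g1 /HK2 g2].
rewrite ler_distl; apply: (tangent_minimizer_between (@loss_tangent N)).
- by move=> v; have := Umin N v%:M; rewrite !L_N_phi mxE eqxx mulr1n.
- by move: g2; rewrite ler_norml => /andP[]; lra.
- by move: g1; rewrite ler_norml => /andP[]; lra.
Qed.

Lemma dtv_new_phi U M (smp : {ffun 'I_M -> sample}) :
  dtv_new phi_law (theta 1) U phi smp =
  `|sigmoid (emp_mean sample_label smp * U i0 i0) - sigmoid 1|.
Proof.
rewrite /dtv_new icl_logit_phi dotv_theta /tv2; set a := sigmoid _; set b := sigmoid 1.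
by rewrite (_ : 1 - a - (1 - b) = - (a - b)) ?normrN; [field | ring].
Qed.

Definition tv_limit : R := `|sigmoid (mean_label 1 * 3) - sigmoid 1|.

Lemma tv_limit_gt0 : 0 < tv_limit.
Proof. by rewrite normr_gt0 subr_eq0 gt_eqF // sigmoid_lt // mean_label1_gt. Qed.

Lemma tv_deviation_le z u : `|z| <= 1 ->
  `| `|sigmoid (z * u) - sigmoid 1| - tv_limit | <= `|u - 3| + 3 * `|z - mean_label 1|.
Proof.
move=> z1; apply: le_trans (ler_dist_dist _ _) _.
rewrite opprB addrA subrK; apply: le_trans (sigmoid_lipschitz _ _) _.
rewrite (_ : z * u - _ = z * (u - 3) + 3 * (z - mean_label 1)); last by ring.
apply: le_trans (ler_normD _ _) _; rewrite !normrM [`|3|]ger0_norm // lerD2r.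
exact: ler_piMl.
Qed.

Lemma prob_dtv_far (U : 'M[R]_d) M eps :
  (0 < M)%N -> 0 < eps -> `|U i0 i0 - 3| <= eps / 2 ->
  prob_samples phi_law (theta 1) M
    (fun smp => eps < `|dtv_new phi_law (theta 1) U phi smp - tv_limit|)
  <= 1 / (M%:R * (eps / 6) ^+ 2).
Proof.
move=> M0 eps0 Uclose.
apply: (chebyshev_emp_mean (label_law_sum1 1) (label_law_ge0 1) M0 (label_law_mean 1)
  (label_law_var 1)); first by rewrite divr_gt0.
move=> smp; rewrite dtv_new_phi => far.
have := tv_deviation_le (U i0 i0) (norm_emp_mean_label_le1 smp M0); lra.
Qed.

End Model.

Theorem theorem2 (R : realType) (d : nat) (hd : (0 < d)%N) :
  exists (P H : fdist R 'rV[R]_d),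
    (forall N : nat, exists U : 'M[R]_d, is_minimizer P H N U) /\
    exists theta_new : 'rV[R]_d, in_supp H theta_new /\
      forall Ustar : nat -> 'M[R]_d,
        (forall N : nat, is_minimizer P H N (Ustar N)) ->
        forall phiq : 'rV[R]_d, in_supp P phiq ->
          exists c : R, 0 < c /\
            (* d_TV(N,M) --> c in probability as N, M -> oo *)
            forall eps delta : R, 0 < eps -> 0 < delta ->
              exists K : nat, forall N M : nat, (K <= N)%N -> (K <= M)%N ->
                prob_samples P theta_new M
                  (fun smp => eps < `|dtv_new P theta_new (Ustar N) phiq smp - c|)
                <= delta.
Proof.
exists (phi_law R hd), (population R hd); split; first exact: exists_minimizer.
exists (theta hd 1); split; first exact: theta1_in_supp.
move=> Ustar Umin _ [i [_ <-]]; exists (tv_limit R); split; first exact: tv_limit_gt0.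
move=> eps delta eps0 delta0.
have r0 : 0 < (eps / 6) ^+ 2 by rewrite exprn_gt0 ?divr_gt0.
have [K1 HK1] := minimizer_cvg Umin (divr_gt0 eps0 (ltr0Sn _ 1)).
have [K2 HK2] := eventually_natr_gt (delta * (eps / 6) ^+ 2)^-1.
exists (maxn K1 K2.+1) => N M; rewrite !geq_max => /andP[/HK1 UN _] /andP[_ KM].
have M0 : (0 < M)%N by case: M KM.
apply: le_trans (prob_dtv_far M0 eps0 UN) _.
rewrite ler_pdivrMr ?mulr_gt0 ?ltr0n // mulrCA -ler_pdivrMr ?mulr_gt0 // div1r.
exact/ltW/HK2/ltnW.
Qed.
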